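(* Let $\{x_k\}_{k\ge 0}$ be a sequence of iterates computed by the variable sample spectral gradient algorithm described in the context, with $\sum_{k\geq 0}\zeta_k=\bar\zeta<+\infty$. Assume that $\sum_{k\geq 0}\nu_k=\bar\nu<+\infty$ and that $\eta_k\to 0$ as $k\to+\infty$. If $f_{\mathcal N}$ is bounded from below over $\mathbb R^n$ and continuously differentiable, and the gradients $\nabla f_j$, $j=1,\dots,N$, are Lipschitz-continuous on $\mathbb R^n$ with Lipschitz constant $L$, then $$\lim_{k\to+\infty}\|\nabla f_{\mathcal N}(x_k)\|=0.$$
   Context: Problem. $f_1,\dots,f_N:\mathbb R^n\to\mathbb R$ are continuously differentiable, $\mathcal N=\{1,\dots,N\}$, and $f_{\mathcal N}(x)=\frac1N\sum_{j=1}^N f_j(x)$. For a nonempty $\mathcal S\subseteq\mathcal N$ put $f_{\mathcal S}(x)=\frac1{|\mathcal S|}\sum_{j\in\mathcal S}f_j(x)$ and $\nabla f_{\mathcal S}(x)=\frac1{|\mathcal S|}\sum_{j\in\mathcal S}\nabla f_j(x)$. $\|\cdot\|$ is the Euclidean norm. Algorithm (variable sample spectral gradient framework). Fixed parameters: $0<\sigma_m<1<\sigma_M<+\infty$, $0<c_1\le c_2<1$, and $\zeta_k>0$ with $\sum_{k\ge0}\zeta_k<+\infty$. Start from $x_0\in\mathbb R^n$, an initial nonempty subsample $\mathcal N_0\subseteq\mathcal N$ of size $N_0$, and an initial coefficient $\sigma_{-1}\in[\sigma_m,\sigma_M]$. At each iteration $k$: 1. (for $k\ge1$) A sample size $N_k\ge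 N_{k-1}$ and a (randomly generated) subsample $\mathcal N_k\subseteq\mathcal N$ with $|\mathcal N_k|=N_k$ are chosen, according to one of two subsampling rules, fixed for the whole run: nested, i.e. $\mathcal N_{k-1}\subseteq\mathcal N_k$; or non-nested, with the requirement $\mathcal N_{k-1}\cap\mathcal N_k\ne\emptyset$. The statement concerns any resulting realization of the subsamples. 2. (for $k\ge1$) Set $s_{k-1}=x_k-x_{k-1}$ and compute $y_{k-1}$ by one of the following formulas, fixed for the whole run: $y_{k-1}=\nabla f_{\mathcal N_k}(x_k)-\nabla f_{\mathcal N_k}(x_{k-1})$ (nested or non-nested case); $y_{k-1}=\nabla f_{\mathcal N_k}(x_k)-\nabla f_{\mathcal N_{k-1}}(x_{k-1})$ (nested case only); $y_{k-1}=\nabla f_{\mathcal I_k}(x_k)-\nabla f_{\mathcal I_k}(x_{k-1})$ with $\mathcal I_k=\mathcal N_k\cap\mathcal N_{k-1}$ (non-nested case only). Set $\sigma_{k-1}=\frac{s_{k-1}^ty_{k-1}}{s_{k-1}^ts_{k-1}}$ if this quantity is defined and lies in $[\sigma_m,\sigma_M]$, and $\sigma_{k-1}=1$ otherwise. 3. Set $d_k=-\sigma_{k-1}^{-1}\nabla f_{\mathcal N_k}(x_k)$. 4. Take a steplength $\alpha_k>0$ satisfying both $$f_{\mathcal N_k}(x_k+\alpha_kd_k)\le f_{\mathcal N_k}(x_k)+c_1\alpha_k\nabla f_{\mathcal N_k}(x_k)^td_k+\zeta_k,$$ $$\nabla f_{\mathcal N_k}(x_k+\alpha_kd_k)^td_k\ge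 c_2\nabla f_{\mathcal N_k}(x_k)^td_k.$$ 5. Set $x_{k+1}=x_k+\alpha_kd_k$. Approximation errors. For each $k\ge0$, $$\nu_k=\max\{|f_{\mathcal N_k}(x_k)-f_{\mathcal N}(x_k)|,\ |f_{\mathcal N_k}(x_{k+1})-f_{\mathcal N}(x_{k+1})|\},$$ $$\eta_k=\max\Big\{\big|\|\nabla f_{\mathcal N}(x_k)\|^2-\|\nabla f_{\mathcal N_k}(x_k)\|^2\big|,\ \big|\|\nabla f_{\mathcal N}(x_{k+1})\|^2-\|\nabla f_{\mathcal N_k}(x_{k+1})\|^2\big|\Big\}.$$ *)

(* Defs.v *)
From HB Require Import structures.
From mathcomp Require Import all_boot all_order all_algebra.
From mathcomp Require Import boolp classical_sets functions reals.
From mathcomp Require Import topology normedtype sequences derive.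

Set Implicit Arguments.
Unset Strict Implicit.
Unset Printing Implicit Defensive.

Import Order.TTheory GRing.Theory Num.Theory.
Import numFieldNormedType.Exports.

Local Open Scope classical_set_scope.
Local Open Scope ring_scope.

Definition dot (R : realType) (n : nat) (u v : 'rV[R]_n) : R :=
  (u *m v^T) 0 0.

(* The library norm `|u| on 'rV[R]_n is the maximum norm; it induces the same
   topology as enorm but not the same Lipschitz constants. *)
Definition enorm (R : realType) (n : nat) (u : 'rV[R]_n) : R :=
  Num.sqrt (dot u u).

Definition grad (R : realType) (n : nat) (g : 'rV[R]_n -> R) (x : 'rV[R]_n) :
  'rV[R]_n := \row_i 'D_(delta_mx 0 i) g x.

Definition continuously_differentiable (R : realType) (n : nat)
    (g : 'rV[R]_n -> R) : Prop :=
  (forall x, differentiable g x) /\ continuous (grad g).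

Definition lipschitz_gradient (R : realType) (n : nat) (L : R)
    (g : 'rV[R]_n -> R) : Prop :=
  forall x y, enorm (grad g x - grad g y) <= L * enorm (x - y).

Definition favg (R : realType) (n N : nat) (f : 'I_N -> 'rV[R]_n -> R)
    (S : {set 'I_N}) (x : 'rV[R]_n) : R :=
  #|S|%:R^-1 * \sum_(j in S) f j x.

Definition gavg (R : realType) (n N : nat) (f : 'I_N -> 'rV[R]_n -> R)
    (S : {set 'I_N}) (x : 'rV[R]_n) : 'rV[R]_n :=
  #|S|%:R^-1 *: \sum_(j in S) grad (f j) x.

Definition full (N : nat) : {set 'I_N} := [set: 'I_N]%SET.

Variant subsampling_rule := Nested | NonNested.

Variant difference_formula :=
  | CurrentSample
  | SuccessiveSamples
  | CommonSample.

Definition formula_allowed (rule : subsampling_rule)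
    (form : difference_formula) : bool :=
  match form, rule with
  | CurrentSample, _ => true
  | SuccessiveSamples, Nested => true
  | CommonSample, NonNested => true
  | _, _ => false
  end.

Definition next_sample (rule : subsampling_rule) (N : nat)
    (S S' : {set 'I_N}) : bool :=
  (#|S| <= #|S'|)%N &&
  match rule with
  | Nested => S \subset S'
  | NonNested => S :&: S' != finset.set0
  end.

(* x and S are the previous iterate and subsample, x' and S' the current ones *)
Definition gradient_difference (form : difference_formula) (R : realType)
    (n N : nat) (f : 'I_N -> 'rV[R]_n -> R) (S S' : {set 'I_N})
    (x x' : 'rV[R]_n) : 'rV[R]_n :=
  match form with
  | CurrentSample => gavg f S' x' - gavg f S' x
  | SuccessiveSamples => gavg f S' x' - gavg f S x
  | CommonSample => gavg f (S' :&: S) x' - gavg f (S' :&: S) x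
  end.

(* The quotient is undefined exactly when s = 0. *)
Definition spectral_coefficient (R : realType) (n : nat) (sigma_m sigma_M : R)
    (s y : 'rV[R]_n) : R :=
  let q := dot s y / dot s s in
  if (s != 0) && (sigma_m <= q <= sigma_M) then q else 1.

(* Index shift: sigma k stands for the coefficient written sigma_{k-1}, so
   that sigma 0 is the initial one. *)
Record spectral_gradient_run (R : realType) (n N : nat)
    (f : 'I_N -> 'rV[R]_n -> R) (sigma_m sigma_M c1 c2 : R) (zeta : nat -> R)
    (rule : subsampling_rule) (form : difference_formula)
    (S : nat -> {set 'I_N}) (sigma alpha : nat -> R)
    (d x : nat -> 'rV[R]_n) : Prop := SpectralGradientRun {
  run_formula : formula_allowed rule form ;
  run_sample0 : S 0%N != finset.set0 ;
  run_sigma0 : sigma_m <= sigma 0%N <= sigma_M ;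
  run_sample : forall k, next_sample rule (S k) (S k.+1) ;
  run_sigma : forall k, sigma k.+1 =
    spectral_coefficient sigma_m sigma_M (x k.+1 - x k)
      (gradient_difference form f (S k) (S k.+1) (x k) (x k.+1)) ;
  run_direction : forall k, d k = - ((sigma k)^-1 *: gavg f (S k) (x k)) ;
  run_step_gt0 : forall k, 0 < alpha k ;
  run_decrease : forall k,
    favg f (S k) (x k + alpha k *: d k) <=
    favg f (S k) (x k) + c1 * alpha k * dot (gavg f (S k) (x k)) (d k)
      + zeta k ;
  run_curvature : forall k,
    dot (gavg f (S k) (x k + alpha k *: d k)) (d k) >=
    c2 * dot (gavg f (S k) (x k)) (d k) ;
  run_update : forall k, x k.+1 = x k + alpha k *: d k
}.

Definition value_error (R : realType) (n N : nat) (f : 'I_N -> 'rV[R]_n -> R)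
    (S : nat -> {set 'I_N}) (x : nat -> 'rV[R]_n) (k : nat) : R :=
  Num.max `|favg f (S k) (x k) - favg f (full N) (x k)|
          `|favg f (S k) (x k.+1) - favg f (full N) (x k.+1)|.

Definition gradient_error (R : realType) (n N : nat)
    (f : 'I_N -> 'rV[R]_n -> R) (S : nat -> {set 'I_N})
    (x : nat -> 'rV[R]_n) (k : nat) : R :=
  Num.max
    `|enorm (gavg f (full N) (x k)) ^+ 2 - enorm (gavg f (S k) (x k)) ^+ 2|
    `|enorm (gavg f (full N) (x k.+1)) ^+ 2
      - enorm (gavg f (S k) (x k.+1)) ^+ 2|.

(* Main.v *)
(* The decrease condition, transferred from f_{N_k} to f_N at the cost
   2 nu_k, reads f_N(x_{k+1}) <= f_N(x_k) - c1 alpha_k |g_k|^2 / sigma_{k-1}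
   + zeta_k + 2 nu_k, where g_k is the subsampled gradient at x_k.  The
   curvature condition and the Lipschitz bound force
   L alpha_k >= (1 - c2) sigma_{k-1} when g_k <> 0, so the decrease is at least
   a fixed multiple of |g_k|^2; telescoping makes |g_k|^2 summable, and
   eta_k -> 0 carries g_k -> 0 over to the full gradient. *)
Require Import Defs.
From HB Require Import structures.
From mathcomp Require Import all_boot all_order all_algebra.
From mathcomp Require Import boolp classical_sets functions reals.
From mathcomp Require Import topology normedtype sequences derive realfun.
From mathcomp Require Import lra.

Import Order.TTheory GRing.Theory Num.Theory.
Import numFieldNormedType.Exports.

Local Open Scope classical_set_scope.
Local Open Scope ring_scope.

Section Dot.
Context {R : realType} {n : nat}.
Implicit Types (u v w : 'rV[R]_n) (a : R).

Lemma dotC u v : dot u v = dot v u.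
Proof.
by rewrite /dot !mxE; apply: eq_bigr => i _; rewrite !mxE mulrC.
Qed.

Lemma dotDl u v w : dot (u + v) w = dot u w + dot v w.
Proof. by rewrite /dot mulmxDl mxE. Qed.

Lemma dotZl a u v : dot (a *: u) v = a * dot u v.
Proof. by rewrite /dot -scalemxAl mxE. Qed.

Lemma dotNl u v : dot (- u) v = - dot u v.
Proof. by rewrite -scaleN1r dotZl mulN1r. Qed.

Lemma dotBl u v w : dot (u - v) w = dot u w - dot v w.
Proof. by rewrite dotDl dotNl. Qed.

Lemma dotZr a u v : dot u (a *: v) = a * dot u v.
Proof. by rewrite dotC dotZl dotC. Qed.

Lemma dotBr u v w : dot u (v - w) = dot u v - dot u w.
Proof. by rewrite dotC dotBl !(dotC u). Qed.

Lemma dotNr u v : dot u (- v) = - dot u v.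
Proof. by rewrite dotC dotNl dotC. Qed.

Lemma dot_suml (I : finType) (P : pred I) (F : I -> 'rV[R]_n) v :
  dot (\sum_(i | P i) F i) v = \sum_(i | P i) dot (F i) v.
Proof. by rewrite /dot mulmx_suml summxE. Qed.

Lemma dot_ge0 u : 0 <= dot u u.
Proof.
by rewrite /dot mxE sumr_ge0 // => i _; rewrite mxE -expr2 sqr_ge0.
Qed.

Lemma sqr_enorm u : enorm u ^+ 2 = dot u u.
Proof. by rewrite sqr_sqrtr// dot_ge0. Qed.

Lemma enorm_ge0 u : 0 <= enorm u.
Proof. exact: sqrtr_ge0. Qed.

Lemma enormZ a u : 0 <= a -> enorm (a *: u) = a * enorm u.
Proof.
by move=> a0; rewrite /enorm dotZl dotZr mulrA -expr2 sqrtrM ?sqr_ge0//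
  sqrtr_sqr ger0_norm.
Qed.

(** Expanding the square of [u - M *: v] gives [2 * M * dot u v <= dot u u + M ^+ 2 * dot v v], and
    the hypothesis bounds the right side by [2 * M ^+ 2 * dot v v]. This replaces Cauchy-Schwarz. *)
Lemma dot_le_of_enorm_le (M : R) u v :
  0 < M -> enorm u <= M * enorm v -> dot u v <= M * dot v v.
Proof.
move=> M0 uv.
have uv2 : dot u u <= M ^+ 2 * dot v v.
  rewrite -!sqr_enorm -exprMn lerXn2r ?nnegrE ?enorm_ge0//.
  by rewrite mulr_ge0 ?enorm_ge0 ?ltW.
have := dot_ge0 (u - M *: v).
rewrite dotBl !dotBr !dotZl !dotZr (dotC v u) => sq_ge0.
rewrite -(ler_pM2l M0); nra.
Qed.

End Dot.

(** Each summand is bounded separately through [dot_le_of_enorm_le] with constant [L * a], so the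
    average inherits the bound without a triangle inequality for [enorm]. *)
Lemma gavg_monotonicity_le (R : realType) (n N : nat)
    (f : 'I_N -> 'rV[R]_n -> R) (L : R) (S : {set 'I_N}) (x v : 'rV[R]_n)
    (a : R) :
  0 < L -> 0 < a -> S != finset.set0 ->
  (forall j, lipschitz_gradient L (f j)) ->
  dot (gavg f S (x + a *: v) - gavg f S x) v <= L * a * dot v v.
Proof.
move=> L0 a0 S0 lipf.
have S_gt0 : 0 < #|S|%:R :> R by rewrite ltr0n card_gt0.
rewrite /gavg -scalerBr -sumrB dotZl dot_suml ler_pdivrMl//.
(* The right side is spread into [#|S|] equal terms, to be compared summand by summand. *)
rewrite mulr_natl -sumr_const; apply: ler_sum => j _.
apply: dot_le_of_enorm_le; first exact: mulr_gt0.
by rewrite (le_trans (lipf j _ _))// addrC addKr enormZ ?mulrA// ltW.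
Qed.

Lemma lipschitz_gradientW (R : realType) (n : nat) (L M : R)
    (g : 'rV[R]_n -> R) :
  L <= M -> lipschitz_gradient L g -> lipschitz_gradient M g.
Proof.
by move=> LM lipg x y; rewrite (le_trans (lipg x y))// ler_wpM2r ?enorm_ge0.
Qed.

Lemma le_limn_series (R : realType) (u : R^nat) (l : R) :
  (forall k, 0 <= u k) -> series u @ \oo --> l -> forall k, series u k <= l.
Proof.
move=> u0 ul k; rewrite -(cvg_lim _ ul)//.
apply: nondecreasing_cvgn_le; last by apply/cvg_ex; exists l.
by apply: nondecreasing_series => i _ _; exact: u0.
Qed.

(** Telescoping bounds the partial sums of [u] by [F 0 - b + l]; having nonnegative terms, the
    series of [u] converges, so its terms vanish in the limit. *)
Lemma cvg0_perturbed_descent (R : realType) (F u e : R^nat) (b l : R) :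
  (forall k, b <= F k) -> (forall k, 0 <= u k) -> (forall k, 0 <= e k) ->
  (forall k, F k.+1 <= F k - u k + e k) -> series e @ \oo --> l ->
  u @ \oo --> 0.
Proof.
move=> Fb u0 e0 descent el.
apply: cvg_series_cvg_0; apply: nondecreasing_is_cvgn.
  by apply: nondecreasing_series => i _ _; exact: u0.
exists (F 0%N - b + l) => _ [k _ <-].
suff : F k <= F 0%N - series u k + series e k.
  by have := Fb k; have := le_limn_series _ _ _ e0 el k; lra.
elim: k => [|k IH]; first by rewrite /series/= !big_geq// subr0 addr0.
rewrite !seriesSr; have := descent k; lra.
Qed.

Section Run.
Context {R : realType} {n N : nat} {f : 'I_N -> 'rV[R]_n -> R}.
Context {sigma_m sigma_M c1 c2 : R} {zeta : nat -> R}.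
Context {rule : subsampling_rule} {form : difference_formula}.
Context {S : nat -> {set 'I_N}} {sigma alpha : nat -> R}.
Context {d x : nat -> 'rV[R]_n}.
Hypothesis run : spectral_gradient_run f sigma_m sigma_M c1 c2 zeta rule form
  S sigma alpha d x.

Lemma run_sample_neq0 k : S k != finset.set0.
Proof.
elim: k => [|k]; first exact: run_sample0 run.
rewrite -!card_gt0 => Sk; case/andP: (run_sample run k) => SS _.
exact: leq_trans SS.
Qed.

(** An accepted quotient is at least [sigma_m], and the fallback value is 1. *)
Lemma run_sigma_gt0 k : 0 < sigma_m -> 0 < sigma k.
Proof.
move=> m0; case: k => [|k].
  by case/andP: (run_sigma0 run) => + _; exact: lt_le_trans.
rewrite (run_sigma run) /spectral_coefficient.
by case: ifP => // /and3P[_ + _]; exact: lt_le_trans.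
Qed.

(** With [d k] equal to [- g / sigma k], the curvature condition bounds the change of gradient along
    [d k] below by [(1 - c2) * dot g g / sigma k], and the Lipschitz condition bounds it above by
    [L * alpha k * dot g g / sigma k ^+ 2]. Keeping the factor [dot g g] covers the case [g = 0]
    without a case split. *)
Lemma run_sufficient_step (L : R) k :
  0 < sigma_m -> 0 < L -> (forall j, lipschitz_gradient L (f j)) ->
  (1 - c2) / L * dot (gavg f (S k) (x k)) (gavg f (S k) (x k)) <=
  alpha k * (dot (gavg f (S k) (x k)) (gavg f (S k) (x k)) / sigma k).
Proof.
move=> m0 L0 lipf; set g := gavg f (S k) (x k).
have s0 := run_sigma_gt0 k m0.
have := run_curvature run k.
have := gavg_monotonicity_le _ _ _ f _ _ (x k) (d k) _ L0 (run_step_gt0 run k)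
  (run_sample_neq0 k) lipf.
set h := gavg f (S k) (_ + _).
rewrite dotBl (run_direction run k) -/g; clearbody g h.
rewrite !dotNr !dotNl !dotZl !dotZr !opprK.
move=> lip curv.
have {curv} : (sigma k)^-1 * ((1 - c2) * dot g g) <=
    (sigma k)^-1 * (L * alpha k * (dot g g / sigma k)) by lra.
rewrite ler_pM2l ?invr_gt0// => step.
by rewrite mulrAC ler_pdivrMr// [leRHS]mulrC [leRHS]mulrA.
Qed.

Lemma run_descent (L : R) k :
  0 < sigma_m -> 0 <= c1 -> 0 < L ->
  (forall j, lipschitz_gradient L (f j)) ->
  favg f (full N) (x k.+1) <= favg f (full N) (x k)
    - c1 * ((1 - c2) / L) * enorm (gavg f (S k) (x k)) ^+ 2
    + (zeta k + 2 * value_error f S x k).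
Proof.
move=> m0 c10 L0 lipf.
have := ler_wpM2l c10 (run_sufficient_step _ k m0 L0 lipf).
have := run_decrease run k; rewrite -(run_update run).
rewrite {1}(run_direction run k) dotNr dotZr sqr_enorm.
set g := gavg _ _ _ => decr step.
have : `|favg f (S k) (x k) - favg f (full N) (x k)| <= value_error f S x k.
  by rewrite le_max lexx.
have : `|favg f (S k) (x k.+1) - favg f (full N) (x k.+1)|
    <= value_error f S x k.
  by rewrite le_max lexx orbT.
(* [e1] passes from the full to the sampled value at [x k.+1], and [e2] from the sampled to the full
   value at [x k]; each costs one [value_error]. *)
rewrite !ler_norml => /andP[e1 _] /andP[_ e2]; lra.
Qed.

End Run.

Theorem theorem3p1 (R : realType) (n N : nat) (f : 'I_N -> 'rV[R]_n -> R)
    (sigma_m sigma_M c1 c2 : R) (zeta : nat -> R)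
    (rule : subsampling_rule) (form : difference_formula)
    (S : nat -> {set 'I_N}) (sigma alpha : nat -> R) (d x : nat -> 'rV[R]_n)
    (zeta_bar nu_bar L : R)
    (f_C1 : forall j, continuously_differentiable (f j))
    (sigma_m_gt0 : 0 < sigma_m) (sigma_m_lt1 : sigma_m < 1)
    (sigma_M_gt1 : 1 < sigma_M)
    (c1_gt0 : 0 < c1) (c1_le_c2 : c1 <= c2) (c2_lt1 : c2 < 1)
    (zeta_gt0 : forall k, 0 < zeta k)
    (zeta_sum : series zeta @ \oo --> zeta_bar)
    (run : spectral_gradient_run f sigma_m sigma_M c1 c2 zeta rule form
             S sigma alpha d x)
    (nu_sum : series (value_error f S x) @ \oo --> nu_bar)
    (eta_cvg0 : gradient_error f S x @ \oo --> (0 : R))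
    (fN_bounded_below : has_lbound (range (favg f (full N))))
    (fN_C1 : continuously_differentiable (favg f (full N)))
    (f_lipschitz : forall j, lipschitz_gradient L (f j)) :
  (fun k => enorm (gavg f (full N) (x k))) @ \oo --> (0 : R).
Proof.
have c1_ge0 := ltW c1_gt0.
(* The sign of [L] is not given, whereas the step bound divides by a positive Lipschitz constant. *)
pose M := Num.max L 1.
have M_gt0 : 0 < M by rewrite lt_max ltr01 orbT.
have lipM j : lipschitz_gradient M (f j).
  by apply: lipschitz_gradientW (f_lipschitz j); rewrite le_max lexx.
have [b lb_b] := fN_bounded_below.
(* The coefficient of the squared gradient in [run_descent], taken with constant [M]. *)
pose kappa := c1 * ((1 - c2) / M).
have kappa_gt0 : 0 < kappa by rewrite !mulr_gt0 ?invr_gt0 ?subr_gt0.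
pose g k := enorm (gavg f (S k) (x k)) ^+ 2.
have value_error_ge0 k : 0 <= value_error f S x k by rewrite le_max normr_ge0.
have g_cvg0 : g @ \oo --> (0 : R).
  suff : (fun k => kappa^-1 * (kappa * g k)) @ \oo --> (0 : R).
    by under eq_fun do rewrite mulKf ?gt_eqF//.
  rewrite -(mulr0 kappa^-1); apply: cvgMl_tmp.
  apply: (@cvg0_perturbed_descent _ (fun k => favg f (full N) (x k)) _
    (fun k => zeta k + 2 * value_error f S x k) b (zeta_bar + 2 * nu_bar)).
  - by move=> k; apply: lb_b; exists (x k).
  - by move=> k; rewrite mulr_ge0 ?sqr_ge0 ?ltW.
  - by move=> k; rewrite addr_ge0 ?mulr_ge0// ltW.
  - by move=> k; exact: (run_descent run).
  - have -> : series (fun k => zeta k + 2 * value_error f S x k) =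
        (fun k => series zeta k + 2 * series (value_error f S x) k).
      by apply/funext => k; rewrite /series/= big_split/= -mulr_sumr.
    by apply: cvgD => //; exact: cvgMl_tmp.
have sq_cvg0 :
    (fun k => enorm (gavg f (full N) (x k)) ^+ 2) @ \oo --> (0 : R).
  apply: (@squeeze_cvgr _ _ _ _ (fun=> 0)
    (fun k => g k + gradient_error f S x k)).
  - apply: nearW => k; rewrite sqr_ge0/= -lerBlDl.
    by rewrite (le_trans (ler_norm _))// le_max lexx.
  - exact: cvg_cst.
  - by rewrite -(addr0 0); exact: cvgD.
(* [gradient_error] compares squared norms, so the limit is first obtained for the squares and then
   carried over by continuity of the square root at 0. *)
have -> : (fun k => enorm (gavg f (full N) (x k))) =
    Num.sqrt \o (fun k => enorm (gavg f (full N) (x k)) ^+ 2).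
  by apply/funext => k; rewrite /= sqrtr_sqr ger0_norm ?enorm_ge0.
rewrite -(@sqrtr0 R).
by apply: continuous_cvg => //; exact: sqrt_continuous.
Qed.
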